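(* Let $H$ be a real Hilbert space, $C\subseteq H$ a nonempty closed convex subset, and $f:H\times H\to\mathbb{R}\cup\{+\infty\}$ a bifunction with $f(x,y)<+\infty$ for all $x,y\in C$. Let $\mathrm{Sol}(C,f)=\{x\in C: f(x,y)\ge 0\ \forall y\in C\}$. Assume: (A1) $f(x,x)=0$ for all $x\in C$; (A4) for every $x\in C$, $f(x,\cdot)$ is convex, lower semicontinuous and subdifferentiable on $C$; (A8) $\mathrm{Sol}(C,f)\neq\emptyset$; (A9) $f$ is strongly pseudomonotone on $C$ with some modulus $\gamma>0$: for all $x,y\in C$, $f(x,y)\ge 0$ implies $f(y,x)\le-\gamma\|x-y\|^2$; (A10) whenever $\{u^k\}\subset C$ is bounded and $g^k\in\partial(f(u^k,\cdot))(u^k)$ for all $k$, the sequence $\{g^k\}$ is bounded. Let $\varphi=\frac{\sqrt5+1}{2}$ and let $\{\beta_k\}_{k\ge 0}$ be a sequence of positive numbers with $\sum_{k=0}^\infty\beta_k=+\infty$ and $\sum_{k=0}^\infty\beta_k^2<+\infty$. Let $x^0,y^1\in C$ be arbitrary and, for $k\ge 1$, define $$x^k=\frac{(\varphi-1)y^k+x^{k-1}}{\varphi},$$ choose any $g(y^k)\in\partial(f(y^k,\cdot))(y^k)$, and set $$\eta_k=\max\{1,\|g(y^k)\|\},\qquad \lambda_k=\frac{\beta_k}{\eta_k},\qquad y^{k+1}=P_C\left(x^k-\lambda_k g(y^k)\right).$$ Then the sequence $\{x^k\}$ converges strongly (in norm) to the unique element of $\mathrm{Sol}(C,f)$.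
   Context: $P_C$ is the metric projection of $H$ onto $C$. For a convex function $g:H\to(-\infty,+\infty]$, $\partial g(x)=\{w\in H: g(y)-g(x)\ge\langle w,y-x\rangle\ \forall y\in H\}$; $\partial(f(x,\cdot))(x)$ is the subdifferential of the function $f(x,\cdot)$ at the point $x$. $g$ is subdifferentiable on $C$ if $\partial g(x)\ne\emptyset$ for every $x\in C$. The equilibrium problem asks for $\bar x\in C$ with $f(\bar x,y)\ge 0$ for all $y\in C$; $\mathrm{Sol}(C,f)$ is its solution set. The algorithm also carries the stopping criterion ''stop if $y^{k+1}=y^k=x^k$''; the convergence assertion concerns the infinite sequence produced by the recursion. *)

(* Defs.v *)
From HB Require Import structures.
From mathcomp Require Import all_boot all_order all_algebra.
From mathcomp Require Import all_classical all_reals all_analysis.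

Set Implicit Arguments.
Unset Strict Implicit.
Unset Printing Implicit Defensive.

Import Order.TTheory GRing.Theory Num.Theory.
Import numFieldNormedType.Exports.

Local Open Scope classical_set_scope.
Local Open Scope ring_scope.
Local Open Scope ereal_scope.

(* A real Hilbert space is a complete normed module H together with a
   positive definite symmetric bilinear form (type [{dot H for idfun}])
   satisfying [induces_norm]. *)
Definition induces_norm (R : realType) (H : completeNormedModType R)
    (dot : {dot H for idfun}) : Prop :=
  forall u : H, dot u u = (`|u| ^+ 2)%R.

(* The point of [C] nearest to [x]; it exists and is unique when [C] is a
   nonempty closed convex subset of a Hilbert space, so that the default
   value 0 of [xget] is then never used. *)
Definition metric_proj (R : realType) (H : completeNormedModType R)
    (C : set H) (x : H) : H :=
  xget 0%R [set p | C p /\ forall z, C z -> (`|x - p| <= `|x - z|)%R].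

(* If [g x = +oo] this set is empty, since [+oo - +oo = -oo] here (take
   [y = x]). *)
Definition subdifferential (R : realType) (H : completeNormedModType R)
    (dot : {dot H for idfun}) (g : H -> \bar R) (x : H) : set H :=
  [set w | forall y, (dot w (y - x)%R)%:E <= g y - g x].

Definition subdifferentiable_on (R : realType) (H : completeNormedModType R)
    (dot : {dot H for idfun}) (C : set H) (g : H -> \bar R) : Prop :=
  forall x, C x -> subdifferential dot g x !=set0.

(* [convex_function] only covers real-valued functions. *)
Definition convex_on (R : realType) (H : completeNormedModType R)
    (C : set H) (g : H -> \bar R) : Prop :=
  forall (x y : H) (t : R), C x -> C y -> (0 < t < 1)%R ->
    g (t *: x + (1 - t) *: y)%R <= t%:E * g x + (1 - t)%:E * g y.

(* Lower semicontinuity of the restriction to [C]: in [subspace C] the points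
   outside [C] are isolated, so they impose no condition. *)
Definition lsc_on (R : realType) (H : completeNormedModType R)
    (C : set H) (g : H -> \bar R) : Prop :=
  lower_semicontinuous (g : subspace C -> \bar R).

Definition Sol (R : realType) (H : completeNormedModType R)
    (C : set H) (f : H -> H -> \bar R) : set H :=
  [set x | C x /\ forall y, C y -> 0 <= f x y].

Definition strongly_pseudomonotone (R : realType)
    (H : completeNormedModType R) (C : set H) (f : H -> H -> \bar R)
    (gamma : R) : Prop :=
  forall x y, C x -> C y -> 0 <= f x y ->
    f y x <= (- (gamma * `|x - y| ^+ 2)%R)%:E.

Definition golden_ratio (R : realType) : R := ((Num.sqrt 5 + 1) / 2)%R.

(* Main.v *)
Require Import Defs.
From HB Require Import structures.
From mathcomp Require Import all_boot all_order all_algebra.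
From mathcomp Require Import all_classical all_reals all_analysis.
From mathcomp Require Import ring lra.

Set Implicit Arguments.
Unset Strict Implicit.
Unset Printing Implicit Defensive.

Import Order.TTheory GRing.Theory Num.Theory.
Import numFieldNormedType.Exports.

Local Open Scope classical_set_scope.
Local Open Scope ring_scope.

(** The iteration is a perturbed projected subgradient method. Write [phi] for
    the golden ratio, [s = phi^-1 < 1], and let [p] be a solution. Since
    [x_k = (1 - s) y_k + s x_(k-1)], every [x_k] is a convex combination of
    points of [C], so it lies in [C]; as the projection brings its argument
    closer to each point of [C], we get [|y_(k+1) - x_k| <= lambda_k |g_k| <=
    beta_k]. Hence, for [k >= 2], [x_k - y_k = s (x_(k-1) - y_k)] has norm at most
    [beta_(k-1)], and replacing [x_k] by [y_k] in the scalar product with the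
    subgradient costs only a summable error.

    Strong pseudomonotonicity gives [gamma |y_k - p|^2 <= <g_k, y_k - p>]
    ([subgradient_coercive]), so projecting onto [C] yields
    ([projected_subgradient_step])
<<
      |y_(k+1) - p|^2 <= |x_k - p|^2 - 2 gamma lambda_k |y_k - p|^2 + e_k
>>
    with [e_k = 2 beta_k^2 + 2 beta_(k-1)^2] summable. By convexity of the
    squared norm, [|x_(k+1) - p|^2] satisfies the same inequality with a
    decrease term multiplied by [1 - s]. In particular [y_k] is bounded, so the
    subgradients [g_k] are bounded, and [lambda_k] is at least a constant
    multiple of [beta_k]. As the [beta_k] are not summable, [|y_k - p|^2] must
    be small infinitely often; [|x_k - p|^2] is then small as well, and the
    summability of the errors makes it stay small ([quasi_fejer_cvg0]). *)

(** * Inner product identities *)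

Lemma dot_sym (R : realType) (H : completeNormedModType R)
    (dot : {dot H for idfun}) (u v : H) : dot u v = dot v u.
Proof. by rewrite hermitian_subproof expr0 mul1r. Qed.

Lemma dotZl (R : realType) (H : completeNormedModType R)
    (dot : {dot H for idfun}) (a : R) (u v : H) :
  dot (a *: u) v = a * dot u v.
Proof. exact: linearZl_LR. Qed.

Lemma dotZr (R : realType) (H : completeNormedModType R)
    (dot : {dot H for idfun}) (a : R) (u v : H) :
  dot u (a *: v) = a * dot u v.
Proof. by rewrite dot_sym dotZl dot_sym. Qed.

Lemma normD_sqr (R : realType) (H : completeNormedModType R)
    (dot : {dot H for idfun}) (hdot : induces_norm dot) (u v : H) :
  `|u + v| ^+ 2 = `|u| ^+ 2 + 2 * dot u v + `|v| ^+ 2.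
Proof.
by rewrite -!hdot linearDl !linearDr /= (dot_sym dot v u); ring.
Qed.

Lemma normB_sqr (R : realType) (H : completeNormedModType R)
    (dot : {dot H for idfun}) (hdot : induces_norm dot) (u v : H) :
  `|u - v| ^+ 2 = `|u| ^+ 2 - 2 * dot u v + `|v| ^+ 2.
Proof. by rewrite (normD_sqr hdot) linearNr normrN mulrN. Qed.

(** The norm comes with its triangle inequality, and the scalar product is its
    polarization, so the inequality is read off from the square of
    [|u + v| <= |u| + |v|]. *)
Lemma cauchy_schwarz (R : realType) (H : completeNormedModType R)
    (dot : {dot H for idfun}) (hdot : induces_norm dot) (u v : H) :
  dot u v <= `|u| * `|v|.
Proof.
have : `|u + v| ^+ 2 <= (`|u| + `|v|) ^+ 2.
  by rewrite ler_pXn2r ?nnegrE ?addr_ge0 ?ler_normD.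
by rewrite (normD_sqr hdot) sqrrD; lra.
Qed.

Lemma parallelogram (R : realType) (H : completeNormedModType R)
    (dot : {dot H for idfun}) (hdot : induces_norm dot) (u v : H) :
  `|u + v| ^+ 2 + `|u - v| ^+ 2 = 2 * `|u| ^+ 2 + 2 * `|v| ^+ 2.
Proof. by rewrite (normD_sqr hdot) (normB_sqr hdot); ring. Qed.

(** The defect of the inequality is [t (1 - t) |u - v|^2]. *)
Lemma norm_conv_sqr (R : realType) (H : completeNormedModType R)
    (dot : {dot H for idfun}) (hdot : induces_norm dot) (t : R) (u v : H) :
  0 <= t <= 1 ->
  `|t *: u + (1 - t) *: v| ^+ 2 <= t * `|u| ^+ 2 + (1 - t) * `|v| ^+ 2.
Proof.
move=> /andP[t0 t1].
have -> : `|t *: u + (1 - t) *: v| ^+ 2 =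
    t * `|u| ^+ 2 + (1 - t) * `|v| ^+ 2 - t * (1 - t) * `|u - v| ^+ 2.
  rewrite (normB_sqr hdot u v) (normD_sqr hdot) -!hdot.
  by rewrite !(dotZl, dotZr); ring.
by rewrite gerBl mulr_ge0 ?exprn_ge0 ?mulr_ge0 ?subr_ge0.
Qed.

(** * Convex combinations *)

Lemma convex_setP (R : realType) (H : completeNormedModType R) (C : set H)
    (C_convex : convex_set C) (t : R) (u v : H) :
  0 <= t <= 1 -> C u -> C v -> C (t *: u + (1 - t) *: v).
Proof.
move=> t01 Cu Cv.
have /andP[t0 t1] := t01.
by have := C_convex u v (Itv01 t0 t1); rewrite !inE; exact.
Qed.

(** This makes [x_k] a genuine convex combination of [y_k] and [x_(k-1)], with
    a positive weight on [y_k]. *)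
Lemma golden_ratio_gt1 (R : realType) : 1 < golden_ratio R.
Proof.
have : 1 < Num.sqrt (5 : R) by rewrite -[ltLHS]sqrtr1 ltr_sqrt; lra.
rewrite /golden_ratio; lra.
Qed.

(** * Metric projection onto a closed convex set *)

(** By the parallelogram identity and the convexity of [C], points whose squared
    distance to [z] is within [a] and [b] of the infimum are at squared distance
    at most [2 a + 2 b] from each other. A minimizing sequence is therefore
    Cauchy, and its limit lies in [C]. *)
Lemma nearest_point_exists (R : realType) (H : completeNormedModType R)
    (dot : {dot H for idfun}) (hdot : induces_norm dot) (C : set H) (z : H) :
  C !=set0 -> closed C -> convex_set C ->
  exists p, C p /\ forall w, C w -> `|z - p| <= `|z - w|.
Proof.
move=> [c0 Cc0] C_closed C_convex.
pose E := [set `|z - w| ^+ 2 | w in C].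
have infE : has_inf E.
  split; first by exists (`|z - c0| ^+ 2); exists c0.
  by exists 0 => _ [w _ <-]; exact: exprn_ge0.
have D_le w : C w -> inf E <= `|z - w| ^+ 2.
  by move=> Cw; apply: ge_inf; [exact: infE.2 | exists w].
have min_exists n : exists w, C w /\ `|z - w| ^+ 2 < inf E + n.+1%:R^-1.
  have [|_ [w Cw <-] ?] := @inf_adherent _ E n.+1%:R^-1 _ infE => //.
  by exists w.
have [s sP] := choice min_exists.
have sC n : C (s n) by case: (sP n).
have s_dist m n : `|s m - s n| ^+ 2 <= 2 * m.+1%:R^-1 + 2 * n.+1%:R^-1.
  have := parallelogram hdot (z - s m) (z - s n).
  have -> : z - s m + (z - s n) =
      2 *: (z - (2^-1 *: s m + (1 - 2^-1) *: s n)).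
    have -> : 1 - 2^-1 = 2^-1 :> R by lra.
    rewrite scalerBr scalerDr !scalerA mulfV// !scale1r.
    by rewrite scaler_nat mulr2n opprD addrACA.
  have -> : z - s m - (z - s n) = s n - s m.
    by rewrite opprB addrC addrA subrK.
  rewrite normrZ exprMn (distrC (s n)) ger0_norm//.
  have half01 : 0 <= (2^-1 : R) <= 1 by apply/andP; split; lra.
  have := D_le _ (convex_setP C_convex half01 (sC m) (sC n)).
  have := (sP m).2; have := (sP n).2.
  by move: (m.+1%:R^-1 : R) (n.+1%:R^-1 : R) => em en; lra.
have s_cvg : cvg (s @ \oo).
  apply/cauchy_cvgP/cauchy_ballP => e e0.
  have [N _ NP] : \forall n \near \oo, n.+1%:R^-1 < e ^+ 2 / 4.
    have := @cvg_harmonic R => /cvgrPdist_lt/(_ (e ^+ 2 / 4)).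
    move=> /(_ ltac:(by rewrite divr_gt0 ?exprn_gt0)) [N _ NP].
    exists N => // n /NP /=; rewrite sub0r normrN ger0_norm//.
  exists (s @` [set n | (N <= n)%N], s @` [set n | (N <= n)%N]).
    by split; exists N => // n Nn; exists n.
  move=> [_ _] /= [[m /NP/= mN <-] [n /NP/= nN <-]]; rewrite -ball_normE /=.
  rewrite -(@ltr_pXn2r _ 2) ?nnegrE ?(ltW e0)//.
  move: (s_dist m n) mN nN.
  by move: (m.+1%:R^-1 : R) (n.+1%:R^-1 : R) => em en; lra.
have sp : s @ \oo --> lim (s @ \oo) by exact: s_cvg.
exists (lim (s @ \oo)); split.
  by apply: (closed_cvg _ C_closed _ _ sp); near=> n; exact: sC.
move=> w Cw; rewrite -(@ler_pXn2r _ 2) ?nnegrE//.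
apply: le_trans (D_le _ Cw).
have dist_cvg : `|z - s n| ^+ 2 @[n --> \oo] --> `|z - lim (s @ \oo)| ^+ 2.
  rewrite expr2; apply: cvgM; apply: cvg_norm; apply: cvgB => //; exact: cvg_cst.
have inf_cvg : inf E + n.+1%:R^-1 @[n --> \oo] --> inf E + 0.
  by apply: cvgD; [exact: cvg_cst | exact: cvg_harmonic].
rewrite -[leRHS]addr0; apply: ler_cvg_to dist_cvg inf_cvg _.
by near=> n; exact/ltW/(sP n).2.
Unshelve. all: by end_near.
Qed.

(** The default value in [metric_proj] is not reached. *)
Lemma metric_projP (R : realType) (H : completeNormedModType R)
    (dot : {dot H for idfun}) (hdot : induces_norm dot) (C : set H) (z : H) :
  C !=set0 -> closed C -> convex_set C ->
  C (metric_proj C z) /\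
  forall w, C w -> `|z - metric_proj C z| <= `|z - w|.
Proof.
move=> C0 C_closed C_convex.
have [p pP] := nearest_point_exists hdot z C0 C_closed C_convex.
by rewrite /metric_proj; case: xgetP => [_ -> //|/(_ p)].
Qed.

(** Moving from the nearest point [p] a fraction [t] of the way to [w] does not
    get closer to [z], whence [2 <z - p, w - p> <= t |w - p|^2] whenever
    [0 < t <= 1]. *)
Lemma metric_proj_obtuse (R : realType) (H : completeNormedModType R)
    (dot : {dot H for idfun}) (hdot : induces_norm dot) (C : set H) (z w : H) :
  closed C -> convex_set C -> C w ->
  dot (z - metric_proj C z) (w - metric_proj C z) <= 0.
Proof.
move=> C_closed C_convex Cw.
have [|Cp p_min] := metric_projP hdot z _ C_closed C_convex; first by exists w.
move: Cp p_min; set p := metric_proj C z => Cp p_min.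
rewrite leNgt; apply/negP; set s := dot _ _ => s_gt0.
set N := `|w - p| ^+ 2; have N_ge0 : 0 <= N by exact: exprn_ge0.
have sN_gt0 : 0 < s + N by lra.
(* With this step, [t N < s < 2 s], which contradicts the minimality of [p]. *)
pose t := s / (s + N).
have t01 : 0 <= t <= 1.
  by rewrite divr_ge0 ?(ltW s_gt0) ?(ltW sN_gt0)//= ler_pdivrMr// mul1r; lra.
have t_gt0 : 0 < t by exact: divr_gt0.
have tN : t * (s + N) = s by rewrite divfK// gt_eqF.
have : `|z - p| ^+ 2 <= `|(z - p) - t *: (w - p)| ^+ 2.
  rewrite ler_pXn2r ?nnegrE//.
  have := p_min _ (convex_setP C_convex t01 Cw Cp).
  suff -> : z - (t *: w + (1 - t) *: p) = z - p - t *: (w - p) by [].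
  by rewrite scalerBl scale1r scalerBr -addrA -opprD addrCA.
rewrite (normB_sqr hdot (z - p)) dotZr -/s normrZ exprMn (gtr0_norm t_gt0) -/N.
have tt_gt0 : 0 < t * t by exact: mulr_gt0.
by nra.
Qed.

(** The triangle [z, p, w] has an obtuse angle at the projection [p] of [z], so
    the side facing it is the longest. The convergence proof uses this once with
    a solution as [w] and once with [x_k] itself. *)
Lemma metric_proj_fejer (R : realType) (H : completeNormedModType R)
    (dot : {dot H for idfun}) (hdot : induces_norm dot) (C : set H) (z w : H) :
  closed C -> convex_set C -> C w ->
  `|metric_proj C z - w| <= `|z - w|.
Proof.
move=> C_closed C_convex Cw.
have := metric_proj_obtuse hdot z C_closed C_convex Cw.
set p := metric_proj C z => obtuse.
rewrite -(@ler_pXn2r _ 2) ?nnegrE//.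
have -> : z - w = (z - p) - (w - p) by rewrite opprB addrA subrK.
rewrite (normB_sqr hdot (z - p)) (distrC p w).
by have := exprn_ge0 2 (normr_ge0 (z - p)); lra.
Qed.

(** * Quasi-Fejer monotone sequences *)

Lemma nneg_series_bounded (R : realType) (u : nat -> R) :
  (forall k, 0 <= u k) -> (\sum_(0 <= k <oo) (u k)%:E < +oo)%E ->
  has_ubound (range (series u)).
Proof.
move=> u0 u_fin.
have ge_sum n : ((series u n)%:E <= \sum_(0 <= k <oo) (u k)%:E)%E.
  rewrite seriesEnat /= -sumEFin.
  by apply: nneseries_lim_ge => k _ _; rewrite lee_fin.
have sum_ge0 : (0 <= \sum_(0 <= k <oo) (u k)%:E)%E.
  by apply: nneseries_ge0 => k _ _; rewrite lee_fin.
exists (fine (\sum_(0 <= k <oo) (u k)%:E)) => _ [n _ <-].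
by rewrite -lee_fin fineK// ge0_fin_numE.
Qed.

Lemma nneg_series_unbounded (R : realType) (u : nat -> R) :
  (forall k, 0 <= u k) -> (\sum_(0 <= k <oo) (u k)%:E = +oo)%E ->
  ~ has_ubound (range (series u)).
Proof.
move=> u0 u_inf [M uM].
have : (\sum_(0 <= k <oo) (u k)%:E <= M%:E)%E.
  apply: lime_le.
    by apply: is_cvg_nneseries => k _ _; rewrite lee_fin.
  near=> n; rewrite sumEFin lee_fin.
  by have := uM (series u n); rewrite seriesEnat; apply; exists n.
by rewrite u_inf leNgt ltry.
Unshelve. all: by end_near.
Qed.

Lemma nonincreasing_from (R : realType) (v : nat -> R) (N n : nat) :
  (forall k, (N <= k)%N -> v k.+1 <= v k) -> (N <= n)%N -> v n <= v N.
Proof.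
move=> v_dec; elim: n => [|n IHn]; first by rewrite leqn0 => /eqP ->.
rewrite leq_eqVlt => /predU1P[-> //|]; rewrite ltnS => Nn.
exact: le_trans (v_dec _ Nn) (IHn Nn).
Qed.

(** If [t] stayed above some [delta > 0], summing the first inequality would
    bound the partial sums of [b]. So [t k] is small for some [k] beyond any
    index, then so is [a k], and afterwards [a] grows by no more than a tail of
    the convergent series of [e]. *)
Lemma quasi_fejer_cvg0 (R : realType) (a b t e : nat -> R) (kappa : R) (N : nat) :
  0 < kappa -> (forall k, 0 <= a k) -> (forall k, 0 <= b k) ->
  (forall k, 0 <= e k) ->
  ~ has_ubound (range (series b)) -> has_ubound (range (series e)) ->
  (forall k, (N <= k)%N -> a k.+1 <= a k - kappa * b k * t k + e k) ->
  (forall k, (N <= k)%N -> 0 <= t k) ->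
  (forall k, (N <= k)%N -> a k <= 2 * t k + e k) ->
  a @ \oo --> 0.
Proof.
move=> kappa0 a0 b0 e0 b_div e_bnd a_step t0 a_le.
have e_nd : nondecreasing_seq (series e).
  by apply/nondecreasing_seqP => n; rewrite seriesSr lerDl.
have e_cvg := nondecreasing_is_cvgn e_nd e_bnd.
have e_le := nondecreasing_cvgn_le e_nd e_cvg.
move: e_cvg e_le; set L := limn (series e) => e_cvg e_le.
apply/cvgrPdist_lt => eps eps0.
have [M _ MP] : \forall n \near \oo, L - series e n < eps / 5.
  have := e_cvg => /cvgrPdist_lt/(_ (eps / 5) ltac:(by rewrite divr_gt0)).
  by apply: filterS => n; exact/le_lt_trans/ler_norm.
pose N0 := maxn N M.
(* An index [k] with [t k < eps / 5] and a tail of [e] below [eps / 5] from [k]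
   on gives [a n <= 2 t k + e k + (e k + e k.+1 + ...) < 4 eps / 5] for
   [n >= k]. *)
have [k [N0k t_lt]] : exists k, (N0 <= k)%N /\ t k < eps / 5.
  apply: contrapT => no_small; apply: b_div.
  have t_ge k : (N0 <= k)%N -> eps / 5 <= t k.
    by move=> N0k; rewrite leNgt; apply/negP => ?; apply: no_small; exists k.
  pose d := kappa * (eps / 5); have d0 : 0 < d by rewrite mulr_gt0 ?divr_gt0.
  pose v n := a n + d * series b n - series e n.
  have v_dec n : (N0 <= n)%N -> v n.+1 <= v n.
    move=> N0n; rewrite /v !seriesSr.
    have := a_step n (leq_trans (leq_maxl _ _) N0n).
    have : d * b n <= kappa * b n * t n.
      rewrite /d mulrAC; apply: ler_wpM2l; last exact: t_ge.
      by rewrite mulr_ge0 ?(ltW kappa0).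
    lra.
  exists (d^-1 * (v N0 + L)) => _ [n _ <-].
  have b_nd : nondecreasing_seq (series b).
    by apply/nondecreasing_seqP => m; rewrite seriesSr lerDl.
  apply: le_trans (b_nd _ _ (leq_maxl n N0)) _.
  rewrite mulrC ler_pdivlMr// mulrC.
  have := nonincreasing_from v_dec (leq_maxr n N0).
  by rewrite {1}/v; have := a0 (maxn n N0); have := e_le (maxn n N0); lra.
have Nk : (N <= k)%N := leq_trans (leq_maxl _ _) N0k.
have Mk : (M <= k)%N := leq_trans (leq_maxr _ _) N0k.
exists k => // n kn /=.
rewrite sub0r normrN ger0_norm//.
have v_dec m : (k <= m)%N -> a m.+1 - series e m.+1 <= a m - series e m.
  move=> km; rewrite seriesSr.
  have := a_step m (leq_trans Nk km).
  have : 0 <= kappa * b m * t m.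
    by rewrite !mulr_ge0 ?(ltW kappa0)// t0// (leq_trans Nk).
  lra.
have := @nonincreasing_from _ (fun m => a m - series e m) _ _ v_dec kn.
have := a_le _ Nk; have := MP _ Mk; have := e_le n; have := e_le k.+1.
by rewrite seriesSr /=; lra.
Qed.

(** * The equilibrium problem *)

Lemma solution_unique (R : realType) (H : completeNormedModType R)
    (C : set H) (f : H -> H -> \bar R) (gamma : R) (p q : H) :
  0 < gamma -> strongly_pseudomonotone C f gamma ->
  Sol C f p -> Sol C f q -> p = q.
Proof.
move=> gamma0 mono [Cp fp] [Cq fq].
have := le_trans (fq _ Cp) (mono _ _ Cp Cq (fp _ Cq)).
rewrite lee_fin oppr_ge0 pmulr_rle0// => pq_le0.
have : `|p - q| ^+ 2 == 0 by rewrite eq_le pq_le0 exprn_ge0.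
by rewrite expf_eq0 /= normr_eq0 subr_eq0 => /eqP.
Qed.

(** The subgradient inequality of [f y] at [y], tested at the solution [p],
    bounds [<w, p - y>] by [f y p], which strong pseudomonotonicity bounds
    because [f p y >= 0]. *)
Lemma subgradient_coercive (R : realType) (H : completeNormedModType R)
    (dot : {dot H for idfun}) (C : set H) (f : H -> H -> \bar R) (gamma : R)
    (p y w : H) :
  strongly_pseudomonotone C f gamma -> Sol C f p -> C y -> f y y = 0%E ->
  subdifferential dot (f y) y w -> gamma * `|y - p| ^+ 2 <= dot w (y - p).
Proof.
move=> mono [Cp fp] Cy fyy /(_ p); rewrite fyy sube0 => w_le.
have := le_trans w_le (mono _ _ Cp Cy (fp _ Cy)).
by rewrite lee_fin -(opprB y p) linearNr normrN lerN2.
Qed.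

(** One projected step from [x] along a subgradient taken at a nearby point [y].
    Evaluating the subgradient at [y] instead of [x] contributes
    [2 lambda <g, y - x> <= 2 beta beta' <= beta^2 + beta'^2]. *)
Lemma projected_subgradient_step (R : realType) (H : completeNormedModType R)
    (dot : {dot H for idfun}) (hdot : induces_norm dot) (C : set H)
    (p x y g : H) (lambda gamma beta beta' : R) :
  closed C -> convex_set C -> C p -> 0 <= lambda ->
  gamma * `|y - p| ^+ 2 <= dot g (y - p) ->
  lambda * `|g| <= beta -> `|x - y| <= beta' ->
  `|metric_proj C (x - lambda *: g) - p| ^+ 2 <=
    `|x - p| ^+ 2 - 2 * gamma * lambda * `|y - p| ^+ 2
    + 2 * beta ^+ 2 + 2 * beta' ^+ 2.
Proof.
move=> C_closed C_convex Cp lambda0 coer lg_le xy_le.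
have : `|metric_proj C (x - lambda *: g) - p| ^+ 2 <=
       `|(x - p) - lambda *: g| ^+ 2.
  rewrite ler_pXn2r ?nnegrE//.
  have -> : x - p - lambda *: g = x - lambda *: g - p by rewrite addrAC.
  exact: (metric_proj_fejer hdot (x - lambda *: g) C_closed C_convex Cp).
move=> /le_trans; apply.
rewrite (normB_sqr hdot) normrZ (ger0_norm lambda0).
have -> : dot (x - p) (lambda *: g) =
    lambda * (dot g (y - p)) - lambda * dot g (y - x).
  have -> : x - p = (y - p) - (y - x) by rewrite opprB [RHS]addrC addrA subrK.
  by rewrite dotZr dot_sym linearBr mulrBr.
have drift : lambda * dot g (y - x) <= beta * beta'.
  have := cauchy_schwarz hdot g (y - x); rewrite distrC => cs.
  apply: le_trans (ler_wpM2l lambda0 cs) _; rewrite mulrA.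
  by apply: ler_pM => //; rewrite mulr_ge0.
have coer' := ler_wpM2l lambda0 coer.
have lg2 : (lambda * `|g|) ^+ 2 <= beta ^+ 2.
  by rewrite ler_pXn2r ?nnegrE ?mulr_ge0// (le_trans _ lg_le)// mulr_ge0.
have := sqr_ge0 (beta - beta'); have := sqr_ge0 beta'.
by rewrite sqrrB; lra.
Qed.

(** * Convergence of the algorithm *)

Lemma bounded_seqP (R : realType) (V : normedModType R) (u : nat -> V) :
  bounded_fun u <-> exists M, forall k, `|u k| <= M.
Proof.
have Fset : ProperFilter (globally [set: nat]).
  exact: (@globally_properfilter _ _ 0%N).
split=> [/(@ex_bound _ _ _ u _ Fset)[M MP] | [M MP]].
  by exists M => k; exact: MP.
by apply/(@ex_bound _ _ _ u _ Fset); exists M => k _; exact: MP.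
Qed.

Theorem theorem4p2 (R : realType) (H : completeNormedModType R)
    (dot : {dot H for idfun}) (hdot : induces_norm dot)
    (C : set H) (C_neq0 : C !=set0) (C_closed : closed C)
    (C_convex : convex_set C)
    (f : H -> H -> \bar R)
    (f_gt_ninfty : forall x y, (-oo < f x y)%E)
    (f_lt_pinfty : forall x y, C x -> C y -> (f x y < +oo)%E)
    (A1 : forall x, C x -> f x x = 0%E)
    (A4 : forall x, C x ->
       [/\ convex_on C (f x), lsc_on C (f x)
         & subdifferentiable_on dot C (f x)])
    (A8 : Sol C f !=set0)
    (gamma : R) (gamma_gt0 : 0 < gamma)
    (A9 : strongly_pseudomonotone C f gamma)
    (A10 : forall u g : nat -> H,
       (forall k, C (u k)) -> bounded_fun u ->
       (forall k, subdifferential dot (f (u k)) (u k) (g k)) ->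
       bounded_fun g)
    (beta : nat -> R) (beta_gt0 : forall k, 0 < beta k)
    (sum_beta : (\sum_(0 <= k <oo) (beta k)%:E = +oo)%E)
    (sum_beta2 : (\sum_(0 <= k <oo) (beta k ^+ 2)%:E < +oo)%E)
    (x y g : nat -> H) (eta lambda : nat -> R)
    (x0C : C (x 0%N)) (y1C : C (y 1%N))
    (x_def : forall k, (1 <= k)%N ->
       x k = (golden_ratio R)^-1 *:
               ((golden_ratio R - 1) *: y k + x k.-1))
    (g_def : forall k, (1 <= k)%N ->
       subdifferential dot (f (y k)) (y k) (g k))
    (eta_def : forall k, (1 <= k)%N -> eta k = Num.max 1 `|g k|)
    (lambda_def : forall k, (1 <= k)%N -> lambda k = beta k / eta k)
    (y_def : forall k, (1 <= k)%N ->
       y k.+1 = metric_proj C (x k - lambda k *: g k)) :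
  exists xbar : H, Sol C f = [set xbar] /\ x @ \oo --> xbar.
Proof.
have [p Sp] := A8; have [Cp _] := Sp.
exists p; split.
  apply/seteqP; split=> [q Sq | _ -> //].
  exact: solution_unique gamma_gt0 A9 Sq Sp.
pose s := (golden_ratio R)^-1.
have phi1 := golden_ratio_gt1 R.
have phi_gt0 : 0 < golden_ratio R by lra.
have s_gt0 : 0 < s by rewrite invr_gt0.
have s_lt1 : s < 1 by rewrite invf_lt1.
have t01 : 0 <= 1 - s <= 1 by apply/andP; split; lra.
(* The weight [(phi - 1) / phi] of [y k] is [1 - s]. *)
have x_conv k : (1 <= k)%N ->
    x k = (1 - s) *: y k + (1 - (1 - s)) *: x k.-1.
  move=> k1; rewrite x_def// scalerDr scalerA -/s mulrBr mulr1.
  by rewrite /s mulVf ?gt_eqF// opprB addrCA subrr addr0.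
have proj_in z : C (metric_proj C z).
  by have [] := metric_projP hdot z C_neq0 C_closed C_convex.
have yC k : (1 <= k)%N -> C (y k).
  by case: k => [//|[//|k] _]; rewrite y_def.
have xC k : C (x k).
  elim: k => [//|k IHk]; rewrite x_conv//.
  by apply: convex_setP => //; exact: yC.
have eta_ge1 k : (1 <= k)%N -> 1 <= eta k.
  by move=> k1; rewrite eta_def// le_max lexx.
have lambda_gt0 k : (1 <= k)%N -> 0 < lambda k.
  move=> k1; rewrite lambda_def// divr_gt0//.
  exact: lt_le_trans (eta_ge1 _ k1).
have lg_le k : (1 <= k)%N -> lambda k * `|g k| <= beta k.
  move=> k1; rewrite lambda_def// mulrAC ler_pdivrMr; last first.
    exact: lt_le_trans (eta_ge1 _ k1).
  by rewrite ler_pM2l// eta_def// le_max lexx orbT.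
have yx_le k : (1 <= k)%N -> `|y k.+1 - x k| <= beta k.
  move=> k1; rewrite y_def//.
  apply: le_trans (metric_proj_fejer hdot _ C_closed C_convex (xC k)) _.
  rewrite addrAC subrr add0r normrN normrZ (gtr0_norm (lambda_gt0 _ k1)).
  exact: lg_le.
have xy_le k : (2 <= k)%N -> `|x k - y k| <= beta k.-1.
  case: k => [//|k] k2; rewrite x_conv//=.
  have -> : (1 - s) *: y k.+1 + (1 - (1 - s)) *: x k - y k.+1 =
      s *: (x k - y k.+1).
    rewrite scalerBl scale1r opprB [1 + (s - 1)]addrC subrK.
    by rewrite scalerBr addrAC [_ - _ - y _]addrAC subrr sub0r addrC.
  rewrite normrZ (gtr0_norm s_gt0) distrC.
  by apply: le_trans (ler_piMl _ (ltW s_lt1)) (yx_le _ _).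
pose a k := `|x k - p| ^+ 2.
pose d k := `|y k - p| ^+ 2.
pose e k := 2 * beta k ^+ 2 + 2 * beta k.-1 ^+ 2.
have e_ge0 k : 0 <= e k by rewrite addr_ge0// mulr_ge0// sqr_ge0.
have y_step k : (2 <= k)%N ->
    d k.+1 <= a k - 2 * gamma * lambda k * d k + e k.
  move=> k2; have k1 : (1 <= k)%N by exact: ltnW.
  rewrite /d y_def// /e addrA.
  apply: projected_subgradient_step => //.
  - exact/ltW/lambda_gt0.
  - by apply: subgradient_coercive A9 Sp _ _ _; auto.
  - exact: lg_le.
  - exact: xy_le.
have x_step k : a k.+1 <= (1 - s) * d k.+1 + (1 - (1 - s)) * a k.
  rewrite /a x_conv//=.
  have -> : (1 - s) *: y k.+1 + (1 - (1 - s)) *: x k - p =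
      (1 - s) *: (y k.+1 - p) + (1 - (1 - s)) *: (x k - p).
    rewrite !scalerBr addrACA -opprD -scalerDl.
    by rewrite [1 - s + _]addrC subrK scale1r.
  exact: norm_conv_sqr.
(* The second half of [e] is the first half delayed by one index. The predecessor
   of 0 is 0, so that [beta 0] occurs once more. *)
have e_bnd : has_ubound (range (series e)).
  have [M MP] := nneg_series_bounded (fun k => sqr_ge0 (beta k)) sum_beta2.
  have eE n : series e n.+1 =
      2 * series (fun k => beta k ^+ 2) n.+1
      + 2 * series (fun k => beta k ^+ 2) n + 2 * beta 0 ^+ 2.
    elim: n => [|n IHn]; last by rewrite seriesSr IHn !seriesSr /e /=; lra.
    by rewrite !seriesSr /e /series /= !big_geq//; lra.
  exists (4 * M + 2 * beta 0 ^+ 2) => _ [n _ <-].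
  apply: (@le_trans _ _ (series e n.+1)); first by rewrite seriesSr lerDl.
  have leM m : series (fun k => beta k ^+ 2) m <= M by apply: MP; exists m.
  by rewrite eE; have := leM n; have := leM n.+1; lra.
have [B BP] := e_bnd.
(* The one-step estimate starts at index 2, the first [k] for which [x k.-1]
   and [y k] are linked by a projection; it controls [y] from index 3 on. *)
have d_bnd k : d k.+3 <= a 2 + B.
  have v_dec m : (2 <= m)%N -> a m.+1 - series e m.+1 <= a m - series e m.
    move=> m2; rewrite seriesSr.
    have := y_step _ m2; have := x_step m.
    have : 0 <= 2 * gamma * lambda m * d m.
      rewrite !mulr_ge0 ?(ltW gamma_gt0) ?exprn_ge0//.
      exact/ltW/lambda_gt0/ltnW.
    have := e_ge0 m; nra.
  have := @nonincreasing_from _ (fun m => a m - series e m) 2 k.+2 v_dec isT.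
  have := y_step k.+2 isT.
  have : 0 <= 2 * gamma * lambda k.+2 * d k.+2.
    rewrite !mulr_ge0 ?(ltW gamma_gt0) ?exprn_ge0//.
    exact/ltW/lambda_gt0.
  have : series e k.+3 <= B by apply: BP; exists k.+3.
  have : 0 <= series e 2 by rewrite /series /= sumr_ge0.
  rewrite (seriesSr e k.+2); lra.
(* [r <= 1 + r^2] turns the bound on [d] into one on the distance. *)
have y_bnd : bounded_fun (fun k => y k.+3).
  apply/bounded_seqP; exists (1 + (a 2 + B) + `|p|) => k.
  rewrite -[y _](subrK p); apply: le_trans (ler_normD _ _) _.
  rewrite lerD2r; have := d_bnd k; rewrite /d.
  by have := sqr_ge0 (`|y k.+3 - p| - 2^-1); rewrite sqrrB; nra.
have /bounded_seqP[G GP] : bounded_fun (fun k => g k.+3).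
  by apply: A10 _ y_bnd _ => k; [exact: yC | exact: g_def].
pose M := Num.max 1 G.
have M_gt0 : 0 < M by rewrite lt_max ltr01.
have lambda_ge k : (3 <= k)%N -> beta k / M <= lambda k.
  case: k => [|[|[|k]]]// _; rewrite lambda_def//.
  rewrite ler_pM2l// lef_pV2 ?posrE//; last first.
    exact: lt_le_trans (eta_ge1 _ _).
  rewrite eta_def// ge_max !le_max lexx /=; apply/orP; right; exact: GP.
(* The constant collects the factor [1 - s] of the averaging step and the
   bound [beta k / M <= lambda k]. *)
have a_cvg : a @ \oo --> 0.
  apply: (@quasi_fejer_cvg0 _ a beta d e ((1 - s) * (2 * gamma / M)) 3) => //.
  - by rewrite mulr_gt0 ?divr_gt0 ?mulr_gt0//; lra.
  - by move=> k; exact: exprn_ge0.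
  - by move=> k; exact: ltW.
  - by apply: nneg_series_unbounded => // k; exact: ltW.
  - move=> k k3; have := y_step k (ltnW k3); have := x_step k.
    have : 2 * gamma * (beta k / M) * d k <= 2 * gamma * lambda k * d k.
      apply: ler_wpM2r; first exact: exprn_ge0.
      by rewrite ler_pM2l ?mulr_gt0//; exact: lambda_ge.
    rewrite (_ : _ * beta k * d k = (1 - s) * (2 * gamma * (beta k / M) * d k)).
      have := e_ge0 k; nra.
    by ring.
  - by move=> k _; exact: exprn_ge0.
  - move=> k k3; rewrite /a /d /e.
    have -> : x k - p = (y k - p) + (x k - y k).
      by rewrite [RHS]addrC addrA subrK.
    have := parallelogram hdot (y k - p) (x k - y k).
    have := sqr_ge0 `|y k - p - (x k - y k)|; have := sqr_ge0 (beta k).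
    have : `|x k - y k| ^+ 2 <= beta k.-1 ^+ 2.
      by rewrite ler_pXn2r ?nnegrE ?(ltW (beta_gt0 _))//; apply/xy_le/ltnW.
    lra.
apply/cvgrPdist_lt => eps eps0.
have := a_cvg => /cvgrPdist_lt/(_ _ (exprn_gt0 2 eps0)).
apply: filterS => k; rewrite sub0r normrN ger0_norm ?exprn_ge0//.
by rewrite ltr_pXn2r ?nnegrE ?(ltW eps0)// distrC.
Qed.
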